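(* Let $F$ be a field with $\mathbb{Q} \subseteq F \subseteq \mathbb{C}$ and let $\lambda \in \mathbb{C}^\ast = \mathbb{C}\setminus\{0\}$. Let $\mathfrak{l}$ be either of the complex Lie algebras $\mathfrak{r}_{3,\lambda}(\mathbb{C})$ or $\mathfrak{r}_{3,\lambda}(\mathbb{C}) \oplus \mathbb{C}$. Then $\mathfrak{l}$ is defined over $F$ if and only if $\lambda^2 + a\lambda + 1 = 0$ for some $a \in F$.
   Context: $\mathfrak{r}_{3,\lambda}(\mathbb{C})$ is the $3$-dimensional complex Lie algebra with basis $X_1, X_2, X_3$ and Lie bracket determined by $[X_1,X_2] = X_2$, $[X_1,X_3] = \lambda X_3$, $[X_2,X_3] = 0$; in $\mathfrak{r}_{3,\lambda}(\mathbb{C}) \oplus \mathbb{C}$ the summand $\mathbb{C}$ is the $1$-dimensional abelian Lie algebra. A complex Lie algebra $\mathfrak{l}$ is defined over a subfield $F \subseteq \mathbb{C}$ if there is a Lie algebra $\mathfrak{m}$ over $F$ with $\mathfrak{l} \cong \mathfrak{m} \otimes_F \mathbb{C}$ as complex Lie algebras (equivalently, $\mathfrak{l}$ has a basis with structure constants in $F$). *)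

(* Defs.v *)
From HB Require Import structures.
From mathcomp Require Import all_boot all_order all_algebra.
From mathcomp Require Import ring complex reals.

Set Implicit Arguments.
Unset Strict Implicit.
Unset Printing Implicit Defensive.

Import GRing.Theory.
Local Open Scope ring_scope.

HB.mixin Record isLieAlgebra (K : fieldType) L of GRing.Lmodule K L := {
  lie : L -> L -> L;
  lieDZl : forall (a : K) (x y z : L), lie (a *: x + y) z = a *: lie x z + lie y z;
  lieDZr : forall (a : K) (x y z : L), lie z (a *: x + y) = a *: lie z x + lie z y;
  liexx : forall x : L, lie x x = 0;
  lie_jacobi : forall x y z : L,
    lie x (lie y z) + lie y (lie z x) + lie z (lie x y) = 0
}.

#[short(type="lieAlgType")]
HB.structure Definition LieAlgebra (K : fieldType) :=
  {L of GRing.Lmodule K L & isLieAlgebra K L}.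

(* finite-dimensional Lie algebras *)
#[short(type="finLieAlgType")]
HB.structure Definition FinLieAlgebra (K : fieldType) :=
  {L of Vector K L & isLieAlgebra K L}.

Section LieTheory.
Variables (K : fieldType) (L : lieAlgType K).
Implicit Types x y z : L.

Lemma lieDl x y z : lie (x + y) z = lie x z + lie y z.
Proof. by rewrite -[x in LHS]scale1r lieDZl scale1r. Qed.

Lemma lieDr x y z : lie z (x + y) = lie z x + lie z y.
Proof. by rewrite -[x in LHS]scale1r lieDZr scale1r. Qed.

Lemma lie0l z : lie 0 z = 0.
Proof. by apply: (addIr (lie 0 z)); rewrite -lieDl !add0r. Qed.

Lemma lie0r z : lie z 0 = 0.
Proof. by apply: (addIr (lie z 0)); rewrite -lieDr !add0r. Qed.

Lemma lieZl a x z : lie (a *: x) z = a *: lie x z.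
Proof. by rewrite -[a *: x]addr0 lieDZl lie0l addr0. Qed.

Lemma lieZr a x z : lie z (a *: x) = a *: lie z x.
Proof. by rewrite -[a *: x]addr0 lieDZr lie0r addr0. Qed.

Lemma lie_suml I (r : seq I) (f : I -> L) z :
  lie (\sum_(i <- r) f i) z = \sum_(i <- r) lie (f i) z.
Proof. by elim/big_rec2: _ => [|i u v _ <-]; rewrite ?lie0l ?lieDl. Qed.

Lemma lie_sumr I (r : seq I) (f : I -> L) z :
  lie z (\sum_(i <- r) f i) = \sum_(i <- r) lie z (f i).
Proof. by elim/big_rec2: _ => [|i u v _ <-]; rewrite ?lie0r ?lieDr. Qed.

Lemma lieC x y : lie x y = - lie y x.
Proof.
have := liexx (x + y); rewrite lieDl !lieDr !liexx add0r addr0 => /eqP.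
by rewrite addr_eq0 => /eqP.
Qed.

End LieTheory.

Definition lie_isomorphic (K : fieldType) (L L' : lieAlgType K) : Prop :=
  exists f : {linear L -> L'},
    bijective f /\ forall x y : L, f (lie x y) = lie (f x) (f y).

Section Product.
Variables (K : fieldType) (L M : lieAlgType K).

Definition prod_lie (x y : L * M) : L * M := (lie x.1 y.1, lie x.2 y.2).

Fact prod_lieDZl (a : K) (x y z : L * M) :
  prod_lie (a *: x + y) z = a *: prod_lie x z + prod_lie y z.
Proof. by congr (_, _); rewrite /= lieDZl. Qed.

Fact prod_lieDZr (a : K) (x y z : L * M) :
  prod_lie z (a *: x + y) = a *: prod_lie z x + prod_lie z y.
Proof. by congr (_, _); rewrite /= lieDZr. Qed.

Fact prod_liexx (x : L * M) : prod_lie x x = 0.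
Proof. by congr (_, _); rewrite liexx. Qed.

Fact prod_jacobi (x y z : L * M) :
  prod_lie x (prod_lie y z) + prod_lie y (prod_lie z x)
  + prod_lie z (prod_lie x y) = 0.
Proof. by congr (_, _); rewrite /= lie_jacobi. Qed.

HB.instance Definition _ := isLieAlgebra.Build K (L * M)%type
  prod_lieDZl prod_lieDZr prod_liexx prod_jacobi.

End Product.

Definition abelian_lie (K : fieldType) (V : lmodType K) : Type := V.

Section Abelian.
Variables (K : fieldType) (V : lmodType K).

HB.instance Definition _ := GRing.Lmodule.copy (abelian_lie V) V.

Definition zero_lie (x y : abelian_lie V) : abelian_lie V := 0.

Fact zero_lieDZl (a : K) (x y z : abelian_lie V) :
  zero_lie (a *: x + y) z = a *: zero_lie x z + zero_lie y z.
Proof. by rewrite /zero_lie scaler0 addr0. Qed.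

Fact zero_lieDZr (a : K) (x y z : abelian_lie V) :
  zero_lie z (a *: x + y) = a *: zero_lie z x + zero_lie z y.
Proof. by rewrite /zero_lie scaler0 addr0. Qed.

Fact zero_liexx (x : abelian_lie V) : zero_lie x x = 0.
Proof. by []. Qed.

Fact zero_jacobi (x y z : abelian_lie V) :
  zero_lie x (zero_lie y z) + zero_lie y (zero_lie z x)
  + zero_lie z (zero_lie x y) = 0.
Proof. by rewrite /zero_lie !addr0. Qed.

HB.instance Definition _ := isLieAlgebra.Build K (abelian_lie V)
  zero_lieDZl zero_lieDZr zero_liexx zero_jacobi.

End Abelian.


Definition r3 (K : fieldType) (lambda : K) : Type := 'rV[K]_3.

Section R3.
Variables (K : fieldType) (lambda : K).

HB.instance Definition _ := Vector.copy (r3 lambda) 'rV[K]_3.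

Implicit Types x y z : r3 lambda.

Definition r3X1 : r3 lambda := delta_mx 0 (inord 0).
Definition r3X2 : r3 lambda := delta_mx 0 (inord 1).
Definition r3X3 : r3 lambda := delta_mx 0 (inord 2).

Definition r3_coord x (i : nat) : K := (x : 'rV[K]_3) 0 (inord i).

(* the bilinear alternating map with the prescribed values on basis vectors,
   see r3_lie12, r3_lie13 and r3_lie23 *)
Definition r3_lie x y : r3 lambda :=
  (r3_coord x 0 * r3_coord y 1 - r3_coord x 1 * r3_coord y 0) *: r3X2
  + (lambda * (r3_coord x 0 * r3_coord y 2 - r3_coord x 2 * r3_coord y 0))
    *: r3X3.

Fact r3_coordDZ a x y i :
  r3_coord (a *: x + y) i = a * r3_coord x i + r3_coord y i.
Proof. by rewrite /r3_coord !mxE. Qed.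

Fact r3_coordD x y i : r3_coord (x + y) i = r3_coord x i + r3_coord y i.
Proof. by rewrite /r3_coord !mxE. Qed.

Fact r3_coordZ a x i : r3_coord (a *: x) i = a * r3_coord x i.
Proof. by rewrite /r3_coord mxE. Qed.

Fact r3_coord0 i : r3_coord 0 i = 0.
Proof. by rewrite /r3_coord mxE. Qed.

Fact r3_coord_delta (i j : nat) : (i < 3)%N -> (j < 3)%N ->
  r3_coord (delta_mx 0 (inord i)) j = (j == i)%:R.
Proof. by move=> i3 j3; rewrite /r3_coord mxE eqxx -val_eqE /= !inordK. Qed.

Fact r3_coordE x y i : (i < 3)%N -> r3_coord (r3_lie x y) i =
  (r3_coord x 0 * r3_coord y 1 - r3_coord x 1 * r3_coord y 0) * (i == 1)%:R
  + lambda * (r3_coord x 0 * r3_coord y 2 - r3_coord x 2 * r3_coord y 0)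
    * (i == 2)%:R.
Proof.
move=> i3; rewrite r3_coordDZ -[_ *: r3X3]addr0 r3_coordDZ r3_coord0 addr0.
by rewrite !r3_coord_delta.
Qed.

Fact r3_eqP x y : (forall i, (i < 3)%N -> r3_coord x i = r3_coord y i) -> x = y.
Proof.
move=> Exy; apply/rowP => i.
by have := Exy i (ltn_ord i); rewrite /r3_coord inord_val.
Qed.

Fact r3_lieDZl a x y z :
  r3_lie (a *: x + y) z = a *: r3_lie x z + r3_lie y z.
Proof.
by apply: r3_eqP => i i3; rewrite r3_coordDZ !r3_coordE // !r3_coordDZ; ring.
Qed.

Fact r3_lieDZr a x y z :
  r3_lie z (a *: x + y) = a *: r3_lie z x + r3_lie z y.
Proof.
by apply: r3_eqP => i i3; rewrite r3_coordDZ !r3_coordE // !r3_coordDZ; ring.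
Qed.

Fact r3_liexx x : r3_lie x x = 0.
Proof. by apply: r3_eqP => i i3; rewrite r3_coordE // r3_coord0; ring. Qed.

Fact r3_jacobi x y z :
  r3_lie x (r3_lie y z) + r3_lie y (r3_lie z x) + r3_lie z (r3_lie x y) = 0.
Proof.
by apply: r3_eqP => i i3; rewrite 2!r3_coordD r3_coord0 !r3_coordE //=; ring.
Qed.

HB.instance Definition _ := isLieAlgebra.Build K (r3 lambda)
  r3_lieDZl r3_lieDZr r3_liexx r3_jacobi.

Fact r3_lieE x y : lie x y = r3_lie x y.
Proof. by []. Qed.

Lemma r3_lie12 : lie r3X1 r3X2 = r3X2.
Proof.
by apply: r3_eqP => i i3; rewrite r3_lieE r3_coordE // !r3_coord_delta //=; ring.
Qed.

Lemma r3_lie13 : lie r3X1 r3X3 = lambda *: r3X3.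
Proof.
apply: r3_eqP => i i3.
by rewrite r3_coordZ r3_lieE r3_coordE // !r3_coord_delta //=; ring.
Qed.

Lemma r3_lie23 : lie r3X2 r3X3 = 0.
Proof.
apply: r3_eqP => i i3.
by rewrite r3_coord0 r3_lieE r3_coordE // !r3_coord_delta //=; ring.
Qed.

End R3.

(* The extension of scalars of m along iota : F -> K, i.e. m (x)_F K, in
   coordinates: an F-basis (b_i) of m gives the K-basis (b_i (x) 1).
   ext_tensor_universal below states that it is the tensor product. *)
Definition scalar_ext (F K : fieldType) (iota : {rmorphism F -> K})
  (m : finLieAlgType F) : Type := 'rV[K]_(\dim {:m}).

Section ScalarExt.
Variables (F K : fieldType) (iota : {rmorphism F -> K}) (m : finLieAlgType F).
Local Notation mK := (scalar_ext iota m).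
Local Notation b := (vbasis {:m}).

HB.instance Definition _ := Vector.copy (scalar_ext iota m) 'rV[K]_(\dim {:m}).

Definition ext_tensor (x : m) (a : K) : mK :=
  a *: \row_(k < \dim {:m}) iota (coord b k x).

Definition ext_coord (u : mK) (i : 'I_(\dim {:m})) : K :=
  (u : 'rV[K]_(\dim {:m})) 0 i.

Definition ext_lie (u v : mK) : mK :=
  \sum_(i < \dim {:m}) \sum_(j < \dim {:m}) ext_tensor (lie b`_i b`_j) (ext_coord u i * ext_coord v j).

Fact ext_coordDZ a u v i :
  ext_coord (a *: u + v) i = a * ext_coord u i + ext_coord v i.
Proof. by rewrite /ext_coord !mxE. Qed.

Fact ext_tensorDl x y a :
  ext_tensor (x + y) a = ext_tensor x a + ext_tensor y a.
Proof.
rewrite /ext_tensor -scalerDr; congr (_ *: _).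
by apply/rowP => k; rewrite !mxE linearD rmorphD.
Qed.

Fact ext_tensorDr x a c :
  ext_tensor x (a + c) = ext_tensor x a + ext_tensor x c.
Proof. exact: scalerDl. Qed.

Fact ext_tensorZ (c : F) x a : ext_tensor (c *: x) a = ext_tensor x (iota c * a).
Proof.
rewrite /ext_tensor [iota c * a]mulrC -scalerA; congr (_ *: _).
by apply/rowP => k; rewrite !mxE linearZ rmorphM.
Qed.

Fact ext_scale_tensor (c : K) x a : c *: ext_tensor x a = ext_tensor x (c * a).
Proof. exact: scalerA. Qed.

Fact ext_tensor0l a : ext_tensor 0 a = 0.
Proof. by apply: (addIr (ext_tensor 0 a)); rewrite -ext_tensorDl !add0r. Qed.

Fact ext_tensor_suml I (r : seq I) (f : I -> m) a :
  ext_tensor (\sum_(i <- r) f i) a = \sum_(i <- r) ext_tensor (f i) a.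
Proof.
by elim/big_rec2: _ => [|i u v _ <-]; rewrite ?ext_tensor0l ?ext_tensorDl.
Qed.

Fact ext_decomp u : u = \sum_(i < \dim {:m}) ext_tensor b`_i (ext_coord u i).
Proof.
have bF := basis_free (vbasisP {:m}).
apply/rowP => k; rewrite summxE (bigD1 k) //= big1 => [|i neik].
  by rewrite !mxE coord_free // eqxx rmorph1 mulr1 addr0.
by rewrite !mxE coord_free // (negPf neik) rmorph0 mulr0.
Qed.

Fact ext_lieDZl a u v w : ext_lie (a *: u + v) w = a *: ext_lie u w + ext_lie v w.
Proof.
rewrite /ext_lie scaler_sumr -big_split; apply: eq_bigr => i _ /=.
rewrite scaler_sumr -big_split; apply: eq_bigr => j _ /=.
by rewrite ext_scale_tensor -ext_tensorDr ext_coordDZ mulrDl mulrA.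
Qed.

Fact ext_lieDZr a u v w : ext_lie w (a *: u + v) = a *: ext_lie w u + ext_lie w v.
Proof.
rewrite /ext_lie scaler_sumr -big_split; apply: eq_bigr => i _ /=.
rewrite scaler_sumr -big_split; apply: eq_bigr => j _ /=.
by rewrite ext_scale_tensor -ext_tensorDr ext_coordDZ mulrDr mulrCA.
Qed.

Fact ext_coord_tensor x a i :
  ext_coord (ext_tensor x a) i = a * iota (coord b i x).
Proof. by rewrite /ext_coord !mxE. Qed.

Fact ext_lie_tensor x y a c :
  ext_lie (ext_tensor x a) (ext_tensor y c) = ext_tensor (lie x y) (a * c).
Proof.
rewrite [in RHS](coord_vbasis (memvf x)) [in RHS](coord_vbasis (memvf y)).
rewrite lie_suml ext_tensor_suml; apply: eq_bigr => i _.
rewrite lie_sumr ext_tensor_suml; apply: eq_bigr => j _.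
rewrite !ext_coord_tensor lieZl lieZr !ext_tensorZ; congr (ext_tensor _ _).
by rewrite [RHS]mulrCA; ring.
Qed.


Fact ext_ind (P : mK -> Prop) :
  (forall x a, P (ext_tensor x a)) -> (forall u v, P u -> P v -> P (u + v)) ->
  forall u, P u.
Proof.
move=> Pt PD u; rewrite [u]ext_decomp; elim/big_ind: _ => //.
by rewrite -(ext_tensor0l 0).
Qed.

Fact ext_lieDl u v w : ext_lie (u + v) w = ext_lie u w + ext_lie v w.
Proof. by rewrite -[u in LHS]scale1r ext_lieDZl scale1r. Qed.

Fact ext_lieDr u v w : ext_lie w (u + v) = ext_lie w u + ext_lie w v.
Proof. by rewrite -[u in LHS]scale1r ext_lieDZr scale1r. Qed.

Fact ext_tensorN x a : ext_tensor (- x) a = - ext_tensor x a.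
Proof. by apply/eqP; rewrite -addr_eq0 -ext_tensorDl addNr ext_tensor0l. Qed.

Fact ext_lieC u v : ext_lie u v + ext_lie v u = 0.
Proof.
elim/ext_ind: u v => [x a|u1 u2 IH1 IH2] v; last first.
  by rewrite ext_lieDl ext_lieDr addrACA IH1 IH2 addr0.
elim/ext_ind: v => [y c|v1 v2 IH1 IH2]; last first.
  by rewrite ext_lieDl ext_lieDr addrACA IH1 IH2 addr0.
by rewrite !ext_lie_tensor [c * a]mulrC -ext_tensorDl lieC addNr ext_tensor0l.
Qed.

Fact ext_liexx u : ext_lie u u = 0.
Proof.
elim/ext_ind: u => [x a|u v uu0 vv0].
  by rewrite ext_lie_tensor liexx ext_tensor0l.
by rewrite ext_lieDl !ext_lieDr uu0 vv0 add0r addr0 ext_lieC.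
Qed.

Fact ext_jacobi u v w :
  ext_lie u (ext_lie v w) + ext_lie v (ext_lie w u) + ext_lie w (ext_lie u v) = 0.
Proof.
pose J u v w :=
  ext_lie u (ext_lie v w) + ext_lie v (ext_lie w u) + ext_lie w (ext_lie u v).
have JC u' v' w' : J u' v' w' = J v' w' u' by rewrite /J -addrA addrC.
have JD u1 u2 v' w' : J (u1 + u2) v' w' = J u1 v' w' + J u2 v' w'.
  by rewrite /J !(ext_lieDl, ext_lieDr) [RHS]addrACA; congr (_ + _); rewrite addrACA.
rewrite -/(J u v w).
elim/ext_ind: u v w => [x a|u1 u2 IH1 IH2] v w; last by rewrite JD IH1 IH2 addr0.
rewrite JC.
elim/ext_ind: v w => [y c|u1 u2 IH1 IH2] w; last by rewrite JD IH1 IH2 addr0.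
rewrite JC.
elim/ext_ind: w => [z d|u1 u2 IH1 IH2]; last by rewrite JD IH1 IH2 addr0.
rewrite -JC -JC /J !ext_lie_tensor.
have -> : c * (d * a) = a * (c * d) by ring.
have -> : d * (a * c) = a * (c * d) by ring.
by rewrite -!ext_tensorDl lie_jacobi ext_tensor0l.
Qed.

HB.instance Definition _ := isLieAlgebra.Build K (scalar_ext iota m)
  ext_lieDZl ext_lieDZr ext_liexx ext_jacobi.

Lemma lie_ext_tensor x y a c :
  lie (ext_tensor x a) (ext_tensor y c) = ext_tensor (lie x y) (a * c).
Proof. exact: ext_lie_tensor. Qed.

Lemma ext_tensor_universal (V : zmodType) (f : m -> K -> V) :
  (forall x y a, f (x + y) a = f x a + f y a) ->
  (forall x a c, f x (a + c) = f x a + f x c) ->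
  (forall (c : F) x a, f (c *: x) a = f x (iota c * a)) ->
  exists g : mK -> V,
    [/\ forall u v, g (u + v) = g u + g v,
        forall x a, g (ext_tensor x a) = f x a
      & forall h : mK -> V, (forall u v, h (u + v) = h u + h v) ->
          (forall x a, h (ext_tensor x a) = f x a) -> h =1 g].
Proof.
move=> fDl fDr fZ; pose g (u : mK) := \sum_(i < \dim {:m}) f b`_i (ext_coord u i).
have gD u v : g (u + v) = g u + g v.
  rewrite /g -big_split; apply: eq_bigr => i _.
  by rewrite /= -fDr -[u in LHS]scale1r ext_coordDZ mul1r.
have gt x a : g (ext_tensor x a) = f x a.
  have f0 : f 0 a = 0 by apply: (addIr (f 0 a)); rewrite -fDl !add0r.
  rewrite [in RHS](coord_vbasis (memvf x)).
  rewrite (big_morph (f ^~ a) (fun x y => fDl x y a) f0).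
  by apply: eq_bigr => i _; rewrite fZ ext_coord_tensor mulrC.
exists g; split=> // h hD ht u.
elim/ext_ind: u => [x a|u v IHu IHv]; first by rewrite ht gt.
by rewrite hD gD IHu IHv.
Qed.

End ScalarExt.

(* If L is finite-dimensional then any Lie algebra m over F whose extension of
   scalars is isomorphic to L is finite-dimensional as well. *)
Definition defined_over (F K : fieldType) (iota : {rmorphism F -> K})
    (L : lieAlgType K) : Prop :=
  exists m : finLieAlgType F, lie_isomorphic L (scalar_ext iota m).

(* Main.v *)
(* Both algebras have all their ad x factoring through r_{3,lambda}, so with y0
   the X1-coordinate of x, tr (ad x) = (1 + lambda) y0 and
   tr (ad x)^2 = (1 + lambda^2) y0^2. For an F-form these traces t, s are in F
   for some x with y0 <> 0, and lambda^-1 + lambda = 2 s / (t^2 - s).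
   Conversely, a suitable multiple of X1 acts on <X2, X3> with rational
   characteristic polynomial, hence is a rational matrix in a cyclic basis
   unless lambda = 1 or lambda = -1, where lambda itself is rational. *)
Require Import Defs.
From HB Require Import structures.
From mathcomp Require Import all_boot all_order all_algebra.
From mathcomp Require Import complex reals.
From mathcomp Require Import ring.

Set Implicit Arguments.
Unset Strict Implicit.
Unset Printing Implicit Defensive.

Import GRing.Theory.
Local Open Scope ring_scope.
Local Open Scope complex_scope.

(* Some F-lattice B (F^k) spanning L is closed under the bracket. *)
Definition has_form (F K : fieldType) (iota : {rmorphism F -> K})
    (L : lieAlgType K) : Prop :=
  exists k, exists2 B : {linear 'rV[K]_k -> L}, bijective B &
    exists c : 'rV[F]_k -> 'rV[F]_k -> 'rV[F]_k, forall x y,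
      lie (B (map_mx iota x)) (B (map_mx iota y)) = B (map_mx iota (c x y)).

(** * Descent of the bracket to [F], and comparison with the extension of scalars *)

Section RationalForm.
Variables (F K : fieldType) (iota : {rmorphism F -> K}) (L : lieAlgType K).
Variables (k : nat) (B : {linear 'rV[K]_k -> L}).
Variable c : 'rV[F]_k -> 'rV[F]_k -> 'rV[F]_k.
Hypothesis B_bij : bijective B.
Hypothesis lieB : forall x y,
  lie (B (map_mx iota x)) (B (map_mx iota y)) = B (map_mx iota (c x y)).

Let phi (x : 'rV[F]_k) : L := B (map_mx iota x).

Let phi_inj : injective phi.
Proof. by move=> x y /(bij_inj B_bij)/map_mx_inj. Qed.

Let phiDZ a x y : phi (a *: x + y) = iota a *: phi x + phi y.
Proof. by rewrite /phi map_mxD map_mxZ linearP. Qed.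

Let phiD x y : phi (x + y) = phi x + phi y.
Proof. by rewrite /phi map_mxD linearD. Qed.

Let phi0 : phi 0 = 0.
Proof. by rewrite /phi map_mx0 linear0. Qed.

Let phi_lie x y : phi (c x y) = lie (phi x) (phi y).
Proof. by rewrite /phi lieB. Qed.

(** This axiom and the three after it are inherited from [L], because [phi] is injective,
    [iota]-semilinear and carries [c] to the bracket. *)
Fact form_lieDZl a x y z : c (a *: x + y) z = a *: c x z + c y z.
Proof. by apply: phi_inj; rewrite phi_lie !phiDZ lieDZl !phi_lie. Qed.

Fact form_lieDZr a x y z : c z (a *: x + y) = a *: c z x + c z y.
Proof. by apply: phi_inj; rewrite phi_lie !phiDZ lieDZr !phi_lie. Qed.

Fact form_liexx x : c x x = 0.
Proof. by apply: phi_inj; rewrite phi_lie liexx phi0. Qed.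

Fact form_jacobi x y z : c x (c y z) + c y (c z x) + c z (c x y) = 0.
Proof. by apply: phi_inj; rewrite !phiD !phi_lie lie_jacobi phi0. Qed.

Let m : finLieAlgType F :=
  HB.pack_for (finLieAlgType F) 'rV[F]_k
    (isLieAlgebra.Build F 'rV[F]_k
       form_lieDZl form_lieDZr form_liexx form_jacobi).

Lemma defined_over_form : defined_over iota L.
Proof.
exists m; pose b := vbasis {: m}; pose d : nat := \dim {: m}.
have bF := basis_free (vbasisP {:m}).
(* [scalar_ext] uses coordinates in [vbasis {: m}], whereas [B] uses the standard basis of row
   vectors; [P] and [Q] are the two transition matrices, with entries from [F]. *)
pose P : 'M[K]_(d, k) := \matrix_(i, l) iota ((b`_i : 'rV[F]_k) 0 l).
pose Q : 'M[K]_(k, d) :=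
  \matrix_(l, j) iota (coord b j (delta_mx 0 l : 'rV[F]_k)).
have PQ : P *m Q = 1%:M.
  apply/matrixP => i j; rewrite !mxE -(rmorph_nat iota) -(coord_free _ _ bF).
  rewrite [X in coord _ _ X](row_sum_delta (b`_i : 'rV[F]_k)).
  rewrite linear_sum rmorph_sum; apply: eq_bigr => l _.
  by rewrite !mxE linearZ rmorphM.
have QP : Q *m P = 1%:M.
  apply/matrixP => l l'; rewrite !mxE.
  have := coord_vbasis (memvf (delta_mx 0 l : m)).
  move/(congr1 (fun v : 'rV[F]_k => iota (v 0 l'))).
  rewrite mxE eqxx /= eq_sym rmorph_nat => ->.
  rewrite [X in iota X]summxE rmorph_sum; apply: eq_bigr => j _.
  by rewrite !mxE rmorphM.
have tP (x : m) a : ext_tensor iota x a *m P = a *: map_mx iota (x : 'rV[F]_k).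
  rewrite -scalemxAl; congr (_ *: _).
  rewrite [in RHS](coord_vbasis (memvf x)).
  apply/rowP => l; rewrite !mxE [X in iota X]summxE rmorph_sum.
  by apply: eq_bigr => j _; rewrite !mxE rmorphM.
pose g (u : scalar_ext iota m) : L := B (u *m P).
have g_lie u v : g (lie u v) = lie (g u) (g v).
  have gD u1 u2 : g (u1 + u2) = g u1 + g u2 by rewrite /g mulmxDl linearD.
  (* By additivity in each argument, pure tensors suffice. *)
  elim/ext_ind: u v => [x a|u1 u2 IH1 IH2] v; last first.
    by rewrite lieDl !gD lieDl IH1 IH2.
  elim/ext_ind: v => [y e|u1 u2 IH1 IH2]; last first.
    by rewrite lieDr !gD lieDr IH1 IH2.
  by rewrite lie_ext_tensor /g !tP !linearZ /= lieZl lieZr lieB scalerA.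
have [B' BK B'K] := B_bij.
pose f (x : L) : scalar_ext iota m := B' x *m Q.
have gK : cancel g f by move=> u; rewrite /f /g BK -mulmxA PQ mulmx1.
have fK : cancel f g by move=> x; rewrite /f /g -mulmxA QP mulmx1 B'K.
have g_lin : linear g by move=> a u v; rewrite /g mulmxDl -scalemxAl linearP.
have f_lin : linear f.
  by move=> a x y; apply: (can_inj gK); rewrite g_lin !fK.
pose fL := HB.pack_for {linear L -> scalar_ext iota m} f
  (GRing.isLinear.Build K L (scalar_ext iota m) *:%R f f_lin).
exists fL; split; first by exists g.
by move=> x y; apply: (can_inj gK); rewrite g_lie /= !fK.
Qed.

End RationalForm.

(** * Construction of forms over [F] *)

Section Forms.
Variables (F K : fieldType) (iota : {rmorphism F -> K}).

Lemma has_form_defined_over (L : lieAlgType K) :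
  has_form iota L -> defined_over iota L.
Proof. by case=> k [B bijB [c lieB]]; exact: defined_over_form bijB lieB. Qed.

(** The abelian summand contributes one extra coordinate, on which every bracket is zero. *)
Lemma has_form_prod_abelian (L : lieAlgType K) :
  has_form iota L -> has_form iota (L * abelian_lie K^o)%type.
Proof.
case=> k [B [B' BK B'K] [c lieB]]; exists (k + 1)%N.
pose g (v : 'rV[K]_(k + 1)) : (L * abelian_lie K^o)%type :=
  (B (lsubmx v), rsubmx v 0 0).
have g_lin : linear g.
  by move=> a u v; rewrite /g !linearP; congr (_, _); rewrite !mxE.
exists (HB.pack_for {linear 'rV[K]_(k + 1) -> (L * abelian_lie K^o)%type} g
  (GRing.isLinear.Build K _ (L * abelian_lie K^o)%type *:%R g g_lin)) => /=.
  exists (fun p => row_mx (B' p.1) (const_mx p.2)) => [v | [x a]].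
    rewrite /= BK -[RHS]hsubmxK; congr row_mx.
    by apply/matrixP => i j; rewrite !ord1 !mxE.
  by rewrite /g row_mxKl row_mxKr B'K mxE.
exists (fun x y => row_mx (c (lsubmx x) (lsubmx y)) 0) => x y.
rewrite /g !map_row_mx !row_mxKl !row_mxKr -!map_lsubmx; congr (_, _).
  exact: lieB.
by rewrite !mxE rmorph0.
Qed.

Definition r3_row (l x0 x1 x2 : K) : r3 l := \row_(i < 3) [:: x0; x1; x2]`_i.

Lemma r3_coord_row l x0 x1 x2 i :
  (i < 3)%N -> r3_coord (r3_row l x0 x1 x2) i = [:: x0; x1; x2]`_i.
Proof. by move=> i3; rewrite /r3_coord mxE inordK. Qed.

(** The standard basis works: its structure constants are 0, 1, [l] and their opposites, so [c] is
    the same bracket formula read over [F]. *)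
Lemma has_form_r3_rational (l : F) : has_form iota (r3 (iota l)).
Proof.
pose g (v : 'rV[K]_3) : r3 (iota l) := v.
have g_lin : linear g by [].
exists 3%N, (HB.pack_for {linear 'rV[K]_3 -> r3 (iota l)} g
  (GRing.isLinear.Build K _ (r3 (iota l)) *:%R g g_lin)).
  by exists g.
exists (@r3_lie F l) => x y; rewrite /g r3_lieE; apply: r3_eqP => i i3.
have /(congr1 iota) E := @r3_coordE F l x y i i3.
rewrite r3_coordE // [RHS]mxE [RHS]E /r3_coord !mxE; ring.
Qed.

(* With t = (1 + lambda) / lambda the eigenvalues t and t * lambda of
   ad (t X1) on <X2, X3> have both sum and product equal to 2 - a, so in the
   cyclic basis X2 + X3, t X2 + t lambda X3 it is a matrix over F. *)
Lemma has_form_r3_cyclic (lambda : K) (a : F) :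
  lambda != 0 -> lambda != 1 -> lambda != -1 ->
  lambda ^+ 2 + iota a * lambda + 1 = 0 -> has_form iota (r3 lambda).
Proof.
move=> nz0 nz1 nzm1 Ea; pose t := (1 + lambda) / lambda.
have nzt : t != 0 by rewrite mulf_neq0 ?invr_eq0 // addrC addr_eq0.
have nzl1 : lambda - 1 != 0 by rewrite subr_eq0.
(* Dividing the quadratic equation by [lambda] gives [- a] as the sum of [lambda] and its inverse,
   and [(1 + lambda) ^+ 2 / lambda] is that sum plus 2. *)
have Ec : iota (2 - a) = t * (1 + lambda).
  rewrite rmorphB rmorph_nat; apply: (mulIf nz0); rewrite /t.
  rewrite mulrBl -[iota a * lambda](addKr (lambda ^+ 2 + 1)).
  by rewrite addrAC Ea; field.
(* Writing [e] for [2 - a], both eigenvalues are roots of [X ^+ 2 - e X + e]. *)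
have Et1 : iota (2 - a) * t = t ^+ 2 + iota (2 - a) by rewrite Ec /t; field.
have Et2 : iota (2 - a) * (t * lambda) = (t * lambda) ^+ 2 + iota (2 - a).
  by rewrite Ec /t; field.
move: t (2 - a) nzt {Ec} Et1 Et2 => t e nzt Et1 Et2.
pose co (v : 'rV[K]_3) := r3_coord (v : r3 lambda).
pose g (v : 'rV[K]_3) : r3 lambda :=
  r3_row lambda (t * co v 0%N) (co v 1%N + t * co v 2%N)
    (co v 1%N + t * lambda * co v 2%N).
have g_lin : linear g.
  move=> b u v; apply: r3_eqP => i i3; rewrite r3_coordDZ !r3_coord_row //.
  by rewrite /co !r3_coordDZ; case: i i3 => [|[|[|]]] //= _; ring.
exists 3%N, (HB.pack_for {linear 'rV[K]_3 -> r3 lambda} g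
  (GRing.isLinear.Build K _ (r3 lambda) *:%R g g_lin)) => /=.
  (* Subtracting the [X2]-coordinate of [g v] from its [X3]-coordinate leaves [t * (lambda - 1)]
     times the last coordinate of [v]. *)
  exists (fun y : r3 lambda =>
    let v2 := (r3_coord y 2 - r3_coord y 1) / (t * (lambda - 1)) in
    r3_row lambda (r3_coord y 0 / t) (r3_coord y 1 - t * v2) v2) => [v | y].
    apply: (@r3_eqP _ lambda) => i i3; rewrite !r3_coord_row //=.
    by case: i i3 => [|[|[|]]] //= _; rewrite /co; field; rewrite ?nzt ?nzl1.
  apply: r3_eqP => i i3; rewrite !r3_coord_row //=.
  rewrite /co !r3_coord_row //=.
  by case: i i3 => [|[|[|]]] //= _; field; rewrite ?nzt ?nzl1.
pose d (x y : 'rV[F]_3) i :=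
  x 0 (inord 0) * y 0 (inord i) - x 0 (inord i) * y 0 (inord 0).
(* Companion matrix of [X ^+ 2 - e X + e]: for the new basis [Y0, Y1, Y2], [[Y0, Y1] = Y2] and
   [[Y0, Y2] = - e Y1 + e Y2]. *)
exists (fun x y => \row_(i < 3)
  [:: 0; - e * d x y 2%N; d x y 1%N + e * d x y 2%N]`_i) => x y.
apply: r3_eqP => i i3; rewrite r3_lieE r3_coordE // !r3_coord_row //=.
rewrite /co /d /r3_coord !mxE !inordK //=.
case: i i3 => [|[|[|]]] //= _;
  rewrite ?rmorph0 ?(rmorphB, rmorphD, rmorphM, rmorphN).
- ring.
- ring: Et1.
- ring: Et2.
Qed.

(** The cyclic basis degenerates at 1, where [X1] acts on [<X2, X3>] as a scalar, and at -1, where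
    [t] vanishes; both values come from [F]. *)
Lemma has_form_r3 (lambda : K) (a : F) : lambda != 0 ->
  lambda ^+ 2 + iota a * lambda + 1 = 0 -> has_form iota (r3 lambda).
Proof.
move=> nz0 Ea; have [->|nz1] := eqVneq lambda 1.
  by rewrite -(rmorph1 iota); exact: has_form_r3_rational.
have [->|nzm1] := eqVneq lambda (- 1).
  by rewrite -(rmorphN1 iota); exact: has_form_r3_rational.
exact: has_form_r3_cyclic Ea.
Qed.

End Forms.

(** * Traces of adjoint maps and the necessary condition *)

Lemma mul_rV_linear (K : fieldType) (p q : nat) (h : 'rV[K]_p -> 'rV[K]_q) :
  linear h -> forall v, v *m lin1_mx h = h v.
Proof.
move=> h_lin v; exact: (@mul_rV_lin1 K p q (HB.pack_for
  {linear 'rV[K]_p -> 'rV[K]_q} h (GRing.isLinear.Build _ _ _ *:%R h h_lin))).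
Qed.

Lemma mulmx_rV_inj (K : fieldType) (p q : nat) (A B : 'M[K]_(p, q)) :
  (forall i, delta_mx 0 i *m A = delta_mx 0 i *m B :> 'rV_q) -> A = B.
Proof. by move=> AB; apply/row_matrixP => i; rewrite !rowE. Qed.

Section AdjointTrace.
Variables (F K : fieldType) (iota : {rmorphism F -> K}) (lambda : K).

Definition r3_ad (y : r3 lambda) : 'M[K]_3 :=
  lin1_mx (lie y : r3 lambda -> r3 lambda).

Lemma r3_adE (y : r3 lambda) (i j : 'I_3) : r3_ad y i j =
  (r3_coord y 0 * (i == 1 :> nat)%:R - r3_coord y 1 * (i == 0 :> nat)%:R)
    * (j == 1 :> nat)%:R
  + lambda
    * (r3_coord y 0 * (i == 2 :> nat)%:R - r3_coord y 2 * (i == 0 :> nat)%:R)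
    * (j == 2 :> nat)%:R.
Proof.
transitivity (r3_coord (lie y (delta_mx 0 (inord i) : r3 lambda)) j).
  by rewrite mxE /r3_coord !inord_val.
by rewrite r3_lieE r3_coordE // !r3_coord_delta // ![_ == (i : nat)]eq_sym.
Qed.

Lemma r3_ad_trace (y : r3 lambda) :
  \tr (r3_ad y) = (1 + lambda) * r3_coord y 0.
Proof.
rewrite /mxtrace; under eq_bigr do rewrite r3_adE.
by rewrite !big_ord_recl big_ord0 /=; ring.
Qed.

Lemma r3_ad_sqr_trace (y : r3 lambda) :
  \tr (r3_ad y *m r3_ad y) = (1 + lambda ^+ 2) * r3_coord y 0 ^+ 2.
Proof.
rewrite /mxtrace; under eq_bigr do
  (rewrite mxE; under eq_bigr do rewrite !r3_adE).
by rewrite !big_ord_recl !big_ord0 /=; ring.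
Qed.

(* [L] is [r3 lambda] up to an abelian direct factor: every [ad] of [L] factors
   through [r3 lambda], where its powers have the same traces. *)
Variables (L : lieAlgType K) (inc : {linear r3 lambda -> L}).
Variable pr : {linear L -> r3 lambda}.
Hypothesis incK : cancel inc pr.
Hypothesis lie_pr : forall x y : L, lie x y = inc (lie (pr x) (pr y)).

(** The matrix of [ad x] in a basis of the form has entries in [F], and over [K] it becomes
    [Q *m r3_ad y *m P] with [P *m Q = 1]; cyclicity of the trace then removes [P] and [Q]. *)
Lemma defined_over_traces : defined_over iota L ->
  exists (y0 : K) (t s : F), [/\ y0 != 0, iota t = (1 + lambda) * y0
    & iota s = (1 + lambda ^+ 2) * y0 ^+ 2].
Proof.
case=> m [f [[g fK gK] f_lie]].
pose b := vbasis {: m}; pose d : nat := \dim {: m}.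
have g_lin : linear g.
  by move=> a u v; apply: (can_inj fK); rewrite linearP !gK.
have bF := basis_free (vbasisP {:m}).
pose A (x : m) : 'M[F]_d := \matrix_(i, j) coord b j (lie x b`_i).
pose P : 'M[K]_(3, d) := lin1_mx (fun v : 'rV[K]_3 => f (inc v) : 'rV[K]_d).
pose Q : 'M[K]_(d, 3) := lin1_mx (fun u : 'rV[K]_d => pr (g u) : 'rV[K]_3).
have mulP (v : r3 lambda) : v *m P = f (inc v).
  by rewrite mul_rV_linear // => a u w; rewrite !linearP.
have mulQ (u : scalar_ext iota m) : u *m Q = pr (g u).
  by rewrite mul_rV_linear // => a v w; rewrite g_lin linearP.
have mul_ad (y v : r3 lambda) : v *m r3_ad y = lie y v.
  by rewrite mul_rV_linear // => a u w; rewrite lieDZr.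
have PQ : P *m Q = 1%:M.
  apply: mulmx_rV_inj => i; rewrite mulmxA (mulP (delta_mx 0 i)).
  by rewrite mulQ fK incK mulmx1.
have tensor_vbasis (i : 'I_d) :
    ext_tensor iota b`_i 1 = delta_mx 0 i :> 'rV[K]_d.
  rewrite /ext_tensor scale1r; apply/rowP => j; rewrite !mxE coord_free //.
  by rewrite rmorph_nat eqxx eq_sym.
have A_fact x :
    map_mx iota (A x) = Q *m r3_ad (pr (g (ext_tensor iota x 1))) *m P.
  apply: mulmx_rV_inj => i; rewrite !mulmxA (mulQ (delta_mx 0 i)) mul_ad mulP.
  rewrite -lie_pr f_lie !gK -tensor_vbasis lie_ext_tensor mulr1.
  rewrite tensor_vbasis -rowE /ext_tensor scale1r.
  by apply/rowP => j; rewrite !mxE.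
(* Otherwise the [X1]-column of [Q] would vanish, contradicting [P *m Q = 1]. *)
have [x nzx] : exists x, r3_coord (pr (g (ext_tensor iota x 1))) 0 != 0.
  have [|/existsPn Q0] := boolP [exists i, Q i (inord 0) != 0].
    case/existsP=> i nzi; exists b`_i.
    by rewrite /r3_coord tensor_vbasis -mulQ -rowE mxE.
  have /matrixP/(_ (inord 0) (inord 0))/eqP := PQ; rewrite mxE big1 => [|i _].
    by rewrite mxE eqxx eq_sym oner_eq0.
  by move/negbNE/eqP: (Q0 i) => ->; rewrite mulr0.
exists (r3_coord (pr (g (ext_tensor iota x 1))) 0), (\tr (A x)),
  (\tr (A x *m A x)).
split=> //.
  by rewrite -r3_ad_trace -trace_map_mx A_fact mxtrace_mulC mulmxA PQ mul1mx.
rewrite -r3_ad_sqr_trace -trace_map_mx map_mxM A_fact.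
by rewrite mulmxA mxtrace_mulC !mulmxA PQ mul1mx -[_ *m P *m Q]mulmxA PQ mulmx1.
Qed.

(** Both [s] and [t ^+ 2 - s] scale as [y0 ^+ 2], so their quotient does not depend on the unknown
    [y0]. *)
Lemma defined_over_quadratic : 2 != 0 :> K -> lambda != 0 ->
  defined_over iota L -> exists a : F, lambda ^+ 2 + iota a * lambda + 1 = 0.
Proof.
move=> nz2 nz0 /defined_over_traces[y0 [t [s [nzy Et Es]]]].
have Ets : iota (t ^+ 2 - s) = 2 * lambda * y0 ^+ 2.
  by rewrite rmorphB rmorphXn Et Es; ring.
exists (- (2 * s) / (t ^+ 2 - s)).
rewrite fmorph_div Ets rmorphN rmorphM rmorph_nat Es.
by field; rewrite nz2 nz0 nzy.
Qed.

End AdjointTrace.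

Theorem proposition5p7 (R : realType) (S : {pred R[i]})
    (F : subFieldType S) (lambda : R[i]) :
  lambda != 0 ->
  (defined_over (\val : {rmorphism F -> R[i]}) (r3 lambda) <->
     exists a : F, lambda ^+ 2 + \val a * lambda + 1 = 0)
  /\
  (defined_over (\val : {rmorphism F -> R[i]})
       (r3 lambda * abelian_lie R[i]^o)%type <->
     exists a : F, lambda ^+ 2 + \val a * lambda + 1 = 0).
Proof.
move=> nz0; have nz2 : 2 != 0 :> R[i] by rewrite Num.Theory.pnatr_eq0.
split; split=> [|[a Ea]].
- exact: (@defined_over_quadratic _ _ _ _ (r3 lambda) idfun idfun).
- exact/has_form_defined_over/(has_form_r3 nz0 Ea).
(* Brackets in the product have second component 0, so they factor through [fst] and [inc]. *)
- pose inc (x : r3 lambda) : (r3 lambda * abelian_lie R[i]^o)%type := (x, 0).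
  have inc_lin : linear inc.
    by move=> b x y; congr (_, _); rewrite /= scaler0 addr0.
  exact: (@defined_over_quadratic _ _ _ _ (r3 lambda * abelian_lie R[i]^o)%type
    (HB.pack_for {linear r3 lambda -> (r3 lambda * abelian_lie R[i]^o)%type} inc
       (GRing.isLinear.Build _ _ (r3 lambda * abelian_lie R[i]^o)%type
          *:%R inc inc_lin)) fst).
- exact/has_form_defined_over/has_form_prod_abelian/(has_form_r3 nz0 Ea).
Qed.
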